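(* Let $n,c\in\mathbb{N}$ and let $r\ge n$. Let $\mathbb{Y}$ be a smooth affine complex variety of dimension $n$ and let $p\in\mathbb{Y}$ be a point. Then the punctual Quot scheme $\mathrm{Quot}_{\mathbb{Y}}^{[p]}(c,r)$ is path connected.
   Context: Here $\mathbb{N}$ denotes the positive integers, and everything is over $\mathbb{C}$. The punctual Quot scheme $\mathrm{Quot}_{\mathbb{Y}}^{[p]}(c,r)$ parametrizes quotients $[\mathcal{O}_{\mathbb{Y}}^{\oplus r}\twoheadrightarrow\mathcal{Q}]$ where $\mathcal{Q}$ is a zero-dimensional sheaf of length $c$ whose (topological) support is the single point $p$. Since the matter is local, one takes $\mathbb{Y}=\mathbb{C}^n$ and $p=O$ the origin. It is then identified with the quotient $\mathcal{N}(n,c,r)^{st}/GL(V)$, as follows. $V$ is a complex vector space of dimension $c$; $\mathcal{N}(n,c)$ is the variety of $n$-tuples $(B_0,\dots,B_{n-1})\in \mathrm{End}(V)^{\oplus n}$ of nilpotent, pairwise commuting operators; $\mathcal{N}(n,c,r)=\mathcal{N}(n,c)\times V^{\oplus r}$; and $\mathcal{N}(n,c,r)^{st}$ is the open subset of stable points $(B_0,\dots,B_{n-1},v_1,\dots,v_r)$, i.e. those for which there is no proper subspace $S\subsetneq V$ with $B_i(S)\subseteq S$ for all $i$ and $v_1,\dots,v_r\in S$. The group $GL(V)$ acts by $g\cdot(B_i,v_j)=(gB_ig^{-1},gv_j)$. Path connectedness refers to the classical (analytic) topology on complex points. *)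

(* Defs.v *)
From HB Require Import structures.
From mathcomp.multinomials Require Import -(notations) mpoly.
From mathcomp Require Import all_boot all_order all_algebra generic_quotient.
From mathcomp Require Import all_classical all_reals topology normedtype.
From mathcomp.real_closed Require Import complex.
Import Order.TTheory GRing.Theory Num.Theory.
Import numFieldNormedType.Exports.

Set Implicit Arguments.
Unset Strict Implicit.
Unset Printing Implicit Defensive.

Local Open Scope ring_scope.
Local Open Scope classical_set_scope.
Local Open Scope complex_scope.

(* The analytic topology on the complex numbers, given by the modulus. *)
HB.instance Definition _ (R : realType) := PseudoPointedMetric.copy R[i] R[i]^o.

Section AffineVarieties.
Context {R : realType} {N : nat}.
Local Notation C := R[i].
Local Notation poly := (mpoly N C).
Implicit Types (Y : set ('I_N -> C)) (p : 'I_N -> C) (f g h : poly).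

Definition zariski_closed Y :=
  exists S : set poly, Y = [set x | forall f, S f -> meval x f = 0].

Definition vanishing_ideal Y : set poly :=
  [set f | forall x, Y x -> meval x f = 0].

(* Smoothness of relative dimension [n] over C at [p], by the Jacobian
   criterion: near [p], the ideal of [Y] in affine [N]-space is generated by
   [N - n] elements whose differentials at [p] are linearly independent.  The
   last clause is the equality of ideals in the local ring at [p], with
   denominators cleared. *)
Definition smooth_at (n : nat) Y p :=
  (n <= N)%N /\
  exists g : 'I_(N - n) -> poly,
    [/\ forall j, vanishing_ideal Y (g j),
        row_free (\matrix_(j < N - n, i < N) meval p (mderiv i (g j))) &
        forall f, vanishing_ideal Y f ->
          exists h (a : 'I_(N - n) -> poly),
            meval p h != 0 /\ h * f = \sum_j a j * g j].

Definition smooth_affine_variety (n : nat) Y :=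
  zariski_closed Y /\ forall p, Y p -> smooth_at n Y p.

End AffineVarieties.

Section PunctualQuot.
Context {R : realType} {N : nat}.
Local Notation C := R[i].
Variables (Y : set ('I_N -> C)) (p : 'I_N -> C) (c r : nat).

(* V = C^c; the pair consists of the operators B_i and the vectors v_j. *)
Definition quot_data : Type :=
  {ptws 'I_N -> 'M[C]_c} * {ptws 'I_r -> 'cV[C]_c}.

(* [mmap] is not applicable: the ring 'M_c may be trivial.  The order of the
   factors is irrelevant since this is only used for commuting [B i]. *)
Definition mx_eval (B : 'I_N -> 'M[C]_c) (f : mpoly N C) : 'M[C]_c :=
  \sum_(m <- msupp f) mcoeff m f *: \prod_(i < N) B i ^+ m i.

(* The structures of module over the coordinate ring of Y on V for which V is
   supported at p, i.e. is annihilated by a power of the maximal ideal of p.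
   For Y = C^n (so N = n, and the vanishing ideal is 0) and p = 0, this is the
   variety of n-tuples of commuting nilpotent operators. *)
Definition punctual_module (B : 'I_N -> 'M[C]_c) :=
  [/\ forall i j, B i *m B j = B j *m B i,
      forall f, vanishing_ideal Y f -> mx_eval B f = 0 &
      forall i, exists k : nat, (B i - (p i)%:M) ^+ k = 0].

Definition stable (x : quot_data) :=
  forall S : {vspace 'cV[C]_c},
    (forall i (w : 'cV[C]_c), w \in S -> x.1 i *m w \in S) ->
    (forall j, x.2 j \in S) -> S = fullv.

Definition stable_locus : set quot_data :=
  [set x | punctual_module x.1 /\ stable x].

Definition GL_orbit (x y : quot_data) :=
  exists g : 'M[C]_c, [/\ g \in unitmx,
    forall i, y.1 i = g *m x.1 i *m invmx g &
    forall j, y.2 j = g *m x.2 j].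

Definition GL_rel : rel (set_type stable_locus) :=
  fun x y => `[< GL_orbit (set_val x) (set_val y) >].

Lemma GL_rel_refl : reflexive GL_rel.
Proof.
move=> x; apply/asboolP; exists 1%:M; split; first exact: unitmx1.
  by move=> i; rewrite invmx1 mul1mx mulmx1.
by move=> j; rewrite mul1mx.
Qed.

Lemma GL_rel_sym : symmetric GL_rel.
Proof.
suff H x y : GL_rel x y -> GL_rel y x by move=> x y; apply/idP/idP; exact: H.
move=> /asboolP[g [gu B v]]; apply/asboolP; exists (invmx g); split.
- by rewrite unitmx_inv.
- by move=> i; rewrite B invmxK !mulmxA mulVmx // mul1mx mulmxKV.
- by move=> j; rewrite v mulmxA mulVmx // mul1mx.
Qed.

Lemma GL_rel_trans : transitive GL_rel.
Proof.
move=> y x z /asboolP[g [gu B v]] /asboolP[h [hu B' v']]; apply/asboolP.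
have hgu : h *m g \in unitmx by rewrite unitmx_mul hu.
have hgV : invmx (h *m g) = invmx g *m invmx h.
  by rewrite -[RHS](mulmxK hgu) -!mulmxA (mulKmx hu) mulmxA (mulVmx gu) mul1mx.
exists (h *m g); split=> //.
- by move=> i; rewrite B' B hgV !mulmxA.
- by move=> j; rewrite v' v mulmxA.
Qed.

Canonical GL_equiv := EquivRel GL_rel GL_rel_refl GL_rel_sym GL_rel_trans.

(* A quotient of the free module of rank r, with a basis of its target, is a
   stable point: the v_j are the images of the standard generators.  Changes of
   basis are divided out; [set_type] carries the induced topology. *)
Definition punctual_Quot : topologicalType :=
  quotient_topology {eq_quot GL_equiv}%qT.

End PunctualQuot.

Definition path_connected (R : realType) (T : topologicalType) :=
  (exists x : T, True) /\
  forall x y : T, exists gamma : R -> T,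
    [/\ {within `[0, 1], continuous gamma}, gamma 0 = x & gamma 1 = y].

(* Main.v *)
(* Two stable points x1, x2 are quotients of one stable module W, the submodule
   of V1 + V2 generated by the pairs (v1_j, v2_j).  A quotient of W of dimension c
   is the same as a c-dimensional space of functionals on W that is stable under
   the transposed operators.  Let P1, P2 be two such spaces, P1 <> P2.  Choose a
   stable hyperplane D of P1 containing P1 :&: P2 and a functional b in P2 \ P1
   that is a socle vector modulo P1 :&: P2.  Writing P1 = D + <a>, the spaces
   D + <(1 - t) a + t b> form a line of stable points from P1 to a space that
   meets P2 in a larger subspace; so x1 and x2 are joined by at most c lines.
   A point exists because Newton iteration yields truncated arcs through p on the
   smooth variety Y, hence curvilinear quotients of any length. *)
Require Import Defs.
From mathcomp Require Import all_boot all_algebra all_classical all_reals.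
From mathcomp.real_closed Require Import complex.
From mathcomp.multinomials Require Import -(notations) mpoly.
From mathcomp Require Import all_order topology normedtype ring.
Import Order.TTheory GRing.Theory Num.Theory numFieldNormedType.Exports.

Set Implicit Arguments.
Unset Strict Implicit.
Unset Printing Implicit Defensive.

(** * Concatenation of paths in a topological space *)

Section Paths.
Local Open Scope ring_scope.
Local Open Scope classical_set_scope.
Variables (R : realType) (T : topologicalType).

Definition path_joined (x y : T) :=
  exists gamma : R -> T, [/\ continuous gamma, gamma 0 = x & gamma 1 = y].

Lemma path_joined_refl x : path_joined x x.
Proof. by exists (fun=> x); split => // t; exact: cvg_cst. Qed.

Lemma path_joined_trans : forall y x z,
  path_joined x y -> path_joined y z -> path_joined x z.
Proof.
move=> y x z [f [cf f0 f1]] [g [cg g0 g1]].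
pose h t := if t <= 2^-1 then f (2 * t) else g (2 * t - 1).
have h2 : (2 : R) * 2^-1 = 1 by rewrite mulfV // pnatr_eq0.
have hl t : t <= 2^-1 -> f (2 * t) = h t by rewrite /h => ->.
have hr t : 2^-1 <= t -> g (2 * t - 1) = h t.
  rewrite /h; case: ifP => // tle tge.
  have -> : t = 2^-1 by apply/le_anti/andP.
  by rewrite h2 subrr g0 f1.
exists h; split.
- apply/continuous_subspace_setT.
  have -> : [set: R] = `]-oo, 2^-1] `|` `[2^-1, +oo[.
    apply/seteqP; split => // t _ /=; rewrite !in_itv /= andbT.
    by case: (leP t 2^-1) => [|/ltW]; [left|right].
  have cl k : continuous (fun t : R => 2 * t + k).
    move=> t; apply: cvgD; last exact: cvg_cst.
    by apply: cvgM; [exact: cvg_cst|exact: cvg_id].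
  apply: withinU_continuous.
  + exact: interval_closed.
  + exact: interval_closed.
  + apply: (@subspace_eq_continuous _ _ _ (f \o (fun t => 2 * t + 0))).
      by move=> t; rewrite inE /= in_itv /= addr0; exact: hl.
    by apply: continuous_subspaceT => t; apply: continuous_comp; [exact: cl|exact: cf].
  + apply: (@subspace_eq_continuous _ _ _ (g \o (fun t => 2 * t - 1))).
      by move=> t; rewrite inE /= in_itv /= andbT; exact: hr.
    by apply: continuous_subspaceT => t; apply: continuous_comp; [exact: cl|exact: cg].
- by rewrite /h invr_ge0 ler0n mulr0.
- rewrite /h ifF; first by rewrite mulr1 -[X in _ - X]mulr1n -natrB.
  by apply/negbTE; rewrite -ltNge invf_lt1 ?ltr1n // ltr0n.
Qed.

End Paths.

(** * Continuity of matrix-valued maps and of real lines in the complex numbers *)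

Section Continuity.
Local Open Scope ring_scope.
Local Open Scope classical_set_scope.

Lemma continuous_mx (S T : topologicalType) m n (f : S -> 'M[T]_(m, n)) :
  (forall i j, continuous (fun s => f s i j)) -> continuous f.
Proof.
move=> cf s A [P sP sPA]; apply: filterS (fun t => sPA (f t)) _ => /=.
apply: filter_forall => i; apply: filter_forall => j; exact: cf (sP i j).
Qed.

Lemma continuous_ptws (S T : topologicalType) (I : Type)
    (f : S -> {ptws I -> T}) :
  (forall i, continuous (fun s => f s i)) -> continuous f.
Proof.
move=> cf s; apply/cvg_sup => i; apply/cvg_image.
  apply/seteqP; split=> // y _; exists (fun=> y) => //.
move=> A /= /cf fA.
exists [set g | A (g i)]; first exact: fA.
apply/seteqP; split=> [_ [g Ag <-] //|y Ay]; by exists (fun=> y).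
Qed.

Lemma continuous_affine (R : realType) (a b : R[i]) :
  continuous (fun t : R => a + (real_complex R t) * b).
Proof.
suff cC : continuous (real_complex R : R -> R[i]^o).
  move=> s; apply: (@cvgD _ R[i]^o); first exact: cvg_cst.
  by apply: (@cvgM R[i]); [exact: cC|exact: cvg_cst].
move=> s; apply/cvgrPdist_lt => e e0.
(* A positive element of [R[i]] is real, so the estimate reduces to the absolute value on [R]. *)
have eE : e = (complex.Re e)%:C%C by rewrite RRe_real // gtr0_real.
rewrite eE in e0 *; rewrite ltcR in e0.
near=> t; rewrite -rmorphB normc_def /= expr0n addr0 sqrtr_sqr ltcR.
by near: t; apply: cvgr_dist_lt => //; exact: cvg_id.
Unshelve. all: by end_near. Qed.
End Continuity.

(** * Homomorphisms of modules with chosen generators, quotients and submodules *)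

Section Morphisms.
Local Open Scope ring_scope.
Variables (R : realType) (N r : nat) (Y : set ('I_N -> R[i])) (p : 'I_N -> R[i]).
Local Notation C := R[i].
Local Notation data c := (@quot_data R N c r).

(** A homomorphism over the polynomial ring that respects the chosen vectors. Vectors are columns,
    so [row_free P] means that [P] is surjective and [row_full P] that it is injective. *)
Definition data_hom m c (P : 'M[C]_(c, m)) (x : data m) (y : data c) :=
  (forall i, P *m x.1 i = y.1 i *m P) /\ (forall j, y.2 j = P *m x.2 j).

Lemma data_hom_comp m k c (P : 'M[C]_(c, k)) (Q : 'M[C]_(k, m)) x y z :
  data_hom Q x y -> data_hom P y z -> data_hom (P *m Q) x z.
Proof.
move=> [xy1 xy2] [yz1 yz2]; split=> [i|j].
  by rewrite -mulmxA xy1 !mulmxA yz1.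
by rewrite yz2 xy2 mulmxA.
Qed.

Lemma intertwine_expr m c (P : 'M[C]_(c, m)) A B k :
  P *m A = B *m P -> P *m (A ^+ k) = B ^+ k *m P.
Proof.
move=> AB; elim: k => [|k IH]; first by rewrite !expr0 mulmx1 mul1mx.
by rewrite !exprS -!mulmxE mulmxA AB -!mulmxA IH.
Qed.

Lemma intertwine_shift m c (P : 'M[C]_(c, m)) A B a :
  P *m A = B *m P -> P *m (A - a%:M) = (B - a%:M) *m P.
Proof. by move=> AB; rewrite mulmxBr mulmxBl AB mul_mx_scalar mul_scalar_mx. Qed.

Lemma intertwine_eval m c (P : 'M[C]_(c, m)) (A : 'I_N -> 'M[C]_m) B f :
  (forall i, P *m A i = B i *m P) -> P *m mx_eval A f = mx_eval B f *m P.
Proof.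
move=> AB; rewrite /mx_eval mulmx_sumr mulmx_suml; apply: eq_bigr => a _.
rewrite -scalemxAr -scalemxAl; congr (_ *: _).
apply: (big_ind2 (fun X Z => P *m X = Z *m P)).
- by rewrite mulmx1 mul1mx.
- by move=> X X' Z Z' XX' ZZ'; rewrite -!mulmxE mulmxA XX' -!mulmxA ZZ'.
- by move=> i _; apply: intertwine_expr.
Qed.

(** A surjective [P] cancels on the right, so every relation among the operators of [x] descends to
    [y]. *)
Lemma punctual_quotient m c (P : 'M[C]_(c, m)) x y :
  row_free P -> data_hom P x y -> punctual_module Y p x.1 ->
  punctual_module Y p y.1.
Proof.
move=> fP [xy _] [xC xY xp].
split=> [i j|f fY|i].
- by apply: (row_free_inj fP); rewrite -!mulmxA -!xy !mulmxA -!xy -!mulmxA xC.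
- by apply: (row_free_inj fP); rewrite mul0mx -(intertwine_eval _ xy) xY // mulmx0.
- have [k xk] := xp i; exists k; apply: (row_free_inj fP).
  by rewrite mul0mx -(intertwine_expr _ (intertwine_shift (p i) (xy i))) xk mulmx0.
Qed.

(** [P1] and [P2] are jointly injective, so a relation holds on [x] once it holds on both
    targets. *)
Lemma punctual_joint_sub m c1 c2 (P1 : 'M[C]_(c1, m)) (P2 : 'M[C]_(c2, m)) x y1 y2 :
  row_full (col_mx P1 P2) -> data_hom P1 x y1 -> data_hom P2 x y2 ->
  punctual_module Y p y1.1 -> punctual_module Y p y2.1 ->
  punctual_module Y p x.1.
Proof.
move=> fP [xy1 _] [xy2 _] [C1 Y1 p1] [C2 Y2 p2].
have inj (E F : 'M[C]_m) : P1 *m E = P1 *m F -> P2 *m E = P2 *m F -> E = F.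
  by move=> E1 E2; apply: (row_full_inj fP); rewrite !mul_col_mx E1 E2.
split=> [i j|f fY|i].
- apply: inj; first by rewrite !mulmxA !xy1 -!mulmxA !xy1 !mulmxA C1.
  by rewrite !mulmxA !xy2 -!mulmxA !xy2 !mulmxA C2.
- apply: inj; rewrite mulmx0; first by rewrite (intertwine_eval _ xy1) Y1 // mul0mx.
  by rewrite (intertwine_eval _ xy2) Y2 // mul0mx.
- have [k1 e1] := p1 i; have [k2 e2] := p2 i; exists (k1 + k2)%N.
  apply: inj; rewrite mulmx0.
    rewrite (intertwine_expr _ (intertwine_shift (p i) (xy1 i))).
    by rewrite exprD e1 mul0r mul0mx.
  rewrite (intertwine_expr _ (intertwine_shift (p i) (xy2 i))).
  by rewrite exprD e2 mulr0 mul0mx.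
Qed.

(** The preimage of an invariant subspace containing the generators is again of this kind, hence
    everything; surjectivity of [P] concludes. *)
Lemma stable_quotient m c (P : 'M[C]_(c, m)) x y :
  row_free P -> data_hom P x y -> stable x -> stable y.
Proof.
move=> fP [xy1 xy2] xS S SB Sv.
pose f : 'Hom('cV[C]_m, 'cV[C]_c) := linfun (mulmx P).
have S'T : (f @^-1: S)%VS = fullv.
  apply: xS => [i w|j]; rewrite -!memv_preim !lfunE /=.
    by rewrite mulmxA xy1 -mulmxA; exact: SB.
  by rewrite -xy2.
apply/vspaceP => w; rewrite memvf.
have := memvf (pinvmx P *m w); rewrite -S'T -memv_preim lfunE /= mulmxA.
by rewrite mulmxVp // mul1mx.
Qed.

(** The image of [P] is invariant and contains the generators of [y]. *)
Lemma stable_hom_row_free m c (P : 'M[C]_(c, m)) x y :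
  data_hom P x y -> stable y -> row_free P.
Proof.
move=> [xy1 xy2] yS.
pose f : 'Hom('cV[C]_m, 'cV[C]_c) := linfun (mulmx P).
have fT : limg f = fullv.
  apply: yS => [i w|j].
    move=> /memv_imgP [s _ ->]; apply/memv_imgP; exists (x.1 i *m s).
      exact: memvf.
    by rewrite !lfunE /= !mulmxA xy1.
  by apply/memv_imgP; exists (x.2 j); rewrite ?memvf // lfunE /= xy2.
apply: inj_row_free => v vP; apply/rowP => k; rewrite mxE.
have : delta_mx k 0 \in limg f by rewrite fT memvf.
move=> /memv_imgP [s _]; rewrite lfunE /= => ks.
have := congr1 (fun M => (v *m M) 0 0) ks.
by rewrite mulmxA vP mul0mx -colE !mxE.
Qed.

(** [U] is the inclusion of [S] written in a basis, [V] a retraction given by coordinate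
    functionals. *)
Lemma vspace_basis_mx m (S : {vspace 'cV[C]_m}) :
  exists (U : 'M[C]_(m, \dim S)) (V : 'M[C]_(\dim S, m)),
    [/\ V *m U = 1%:M, forall a, U *m a \in S & forall s, s \in S -> U *m (V *m s) = s].
Proof.
pose U : 'M[C]_(m, \dim S) := \matrix_(i, j) (vbasis S)`_j i 0.
pose V := \matrix_(j, i) coord (vbasis S) j (delta_mx i 0 : 'cV[C]_m).
have VE (w : 'cV[C]_m) : V *m w = \col_j coord (vbasis S) j w.
  apply/colP => j; rewrite !mxE [in RHS](matrix_sum_delta w) linear_sum /=.
  apply: eq_bigr => i _; rewrite mxE big_ord1 linearZ /= mulrC.
  by congr (_ * coord _ _ _); rewrite ord1.
have UE (a : 'cV[C]_(\dim S)) : U *m a = \sum_j a j 0 *: (vbasis S)`_j.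
  apply/colP => i; rewrite mxE summxE; apply: eq_bigr => j _.
  by rewrite !mxE mulrC.
exists U, V; split.
- apply/matrixP => j k.
  have -> : (V *m U) j k = (V *m col k U) j 0.
    by rewrite !mxE; apply: eq_bigr => i _; rewrite !mxE.
  rewrite VE !mxE.
  have -> : col k U = (vbasis S)`_k by apply/colP => i; rewrite !mxE.
  by rewrite coord_free ?(basis_free (vbasisP S)) // eq_sym.
- move=> a; rewrite UE; apply: memv_suml => j _.
  by apply/memvZ/vbasis_mem/mem_nth; rewrite size_tuple.
- move=> s sS; rewrite VE UE [RHS](coord_vbasis sS).
  by apply: eq_bigr => j _; rewrite mxE.
Qed.

(** Strong induction on the dimension: a subspace witnessing the failure of stability is proper, and
    the data restrict to it. The outcome is the submodule generated by the [x.2 j]. *)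
Lemma stable_core m (x : data m) :
  exists k (z : data k) (U : 'M[C]_(m, k)),
    [/\ data_hom U z x, row_full U & stable z].
Proof.
elim/ltn_ind: m x => m IH x.
have [xS|] := EM (stable x).
  exists m, x, 1%:M; split=> //; last by rewrite row_full_unit unitmx1.
  by split=> i; rewrite ?mul1mx ?mulmx1.
move=> /existsNP [S /not_implyP [SB /not_implyP [Sv /eqP SF]]].
have [U [V [VU US UV]]] := vspace_basis_mx S.
have lt_m : (\dim S < m)%N.
  rewrite ltnNge; apply: contra SF => mS.
  by rewrite eqEdim subvf dimvf dim_matrix mulr1.
pose y : data (\dim S) := (fun i => V *m x.1 i *m U, fun j => V *m x.2 j).
have hU : data_hom U y x.
  split=> [i|j] /=; last by rewrite UV.
  apply/matrixP => a b.
  pose e : 'cV[C]_(\dim S) := delta_mx b 0.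
  have /matrixP/(_ a 0) : U *m (V *m (x.1 i *m (U *m e))) = x.1 i *m (U *m e).
    by apply: UV; apply: SB; exact: US.
  by rewrite !mulmxA -!colE !mxE.
have fU : row_full U by apply/row_fullP; exists V.
have [k [z [W [hW fW zS]]]] := IH _ lt_m y.
exists k, z, (U *m W); split=> //; first exact: data_hom_comp hW hU.
have /row_fullP [W' WW] := fW; apply/row_fullP; exists (W' *m V).
by rewrite -mulmxA (mulmxA V) VU mul1mx.
Qed.

Lemma stable_common_cover c1 c2 (x1 : data c1) (x2 : data c2) :
  stable_locus Y p x1 -> stable_locus Y p x2 ->
  exists m (z : data m) (P1 : 'M[C]_(c1, m)) (P2 : 'M[C]_(c2, m)),
    [/\ data_hom P1 z x1, data_hom P2 z x2 & stable_locus Y p z].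
Proof.
move=> [p1 s1] [p2 s2].
pose x : data (c1 + c2) := (fun i => block_mx (x1.1 i) 0 0 (x2.1 i),
                            fun j => col_mx (x1.2 j) (x2.2 j)).
pose Q1 : 'M[C]_(c1, c1 + c2) := row_mx 1%:M 0.
pose Q2 : 'M[C]_(c2, c1 + c2) := row_mx 0 1%:M.
have h1 : data_hom Q1 x x1.
  split=> [i|j]; last by rewrite mul_row_col mul1mx mul0mx addr0.
  by rewrite mul_row_block mul_mx_row !mul1mx !mul0mx !mulmx1 !mulmx0 !addr0.
have h2 : data_hom Q2 x x2.
  split=> [i|j]; last by rewrite mul_row_col mul1mx mul0mx add0r.
  by rewrite mul_row_block mul_mx_row !mul1mx !mul0mx !mulmx1 !mulmx0 !add0r.
have [m [z [U [hU /row_fullP [V VU] zS]]]] := stable_core x.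
have g1 := data_hom_comp hU h1; have g2 := data_hom_comp hU h2.
exists m, z, (Q1 *m U), (Q2 *m U); split=> //; split=> //.
apply: punctual_joint_sub g1 g2 p1 p2; rewrite -mul_col_mx.
apply/row_fullP; exists V.
suff -> : col_mx Q1 Q2 = 1%:M by rewrite mul1mx.
by rewrite scalar_mx_block.
Qed.

End Morphisms.

(* Treat the [f i] one after the other, replacing [s] each time by its last
   iterate under [f i] outside [X]. *)
Lemma socle_exists (T : Type) N (f : 'I_N -> T -> T) (X Y : T -> Prop) t :
  (forall i j s, f i (f j s) = f j (f i s)) ->
  (forall i s, X s -> X (f i s)) -> (forall i s, Y s -> Y (f i s)) ->
  (forall i, exists k, forall s, X (iter k (f i) s)) ->
  Y t -> ~ X t -> exists s, [/\ Y s, ~ X s & forall i, X (f i s)].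
Proof.
move=> fC fX fY fN Yt Xt.
suff H n : (n <= N)%N ->
    exists s, [/\ Y s, ~ X s & forall i : 'I_N, (i < n)%N -> X (f i s)].
  by have [s [Ys Xs fs]] := H N (leqnn N); exists s; split=> // i; exact: fs.
elim: n => [|n IH] nN; first by exists t.
have [s [Ys Xs fs]] := IH (ltnW nN); pose i0 := Ordinal nN.
have ex : exists k, `[< X (iter k (f i0) s) >].
  by have [k Xk] := fN i0; exists k; apply/asboolP.
case: (ex_minnP ex) => -[|k] /asboolP Xk mink //.
exists (iter k (f i0) s); split.
- by elim: (k) => //= l; exact: fY.
- by move=> /asboolP /mink; rewrite ltnn.
- move=> i; rewrite ltnS leq_eqVlt => /orP [/eqP ik|/fs Xfs].
    by have -> : i = i0 by exact: val_inj.
  have -> : f i (iter k (f i0) s) = iter k (f i0) (f i s).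
    by elim: (k) => //= l <-; rewrite fC.
  by elim: (k) => //= l; exact: fX.
Qed.


(** * Lines of stable points and the paths they induce on the Quot scheme *)

Section QuotPaths.
Local Open Scope ring_scope.
Local Open Scope classical_set_scope.
Local Open Scope quotient_scope.
Variables (R : realType) (N r : nat) (Y : set ('I_N -> R[i])) (p : 'I_N -> R[i]).
Local Notation C := R[i].
Local Notation data c := (@quot_data R N c r).
Local Notation Quot c := (@punctual_Quot R N Y p c r).

Local Notation stable_type c := (set_type (@stable_locus R N Y p c r)).

Definition stable_point c (x : data c) (h : stable_locus Y p x) : stable_type c :=
  exist _ x (mem_set h).

Definition Quot_class c (x : data c) (h : stable_locus Y p x) : Quot c :=
  \pi_(Quot c) (stable_point h).

Definition data_joined c (x y : data c) :=
  forall (hx : stable_locus Y p x) (hy : stable_locus Y p y),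
    path_joined R (Quot_class hx) (Quot_class hy).

Lemma data_joined_trans c (y x z : data c) :
  stable_locus Y p y -> data_joined x y -> data_joined y z -> data_joined x z.
Proof. by move=> hy xy yz hx hz; apply: path_joined_trans (xy hx hy) (yz hy hz). Qed.

Lemma orbit_joined c (x y : data c) : GL_orbit x y -> data_joined x y.
Proof.
move=> xy hx hy; suff -> : Quot_class hx = Quot_class hy by exact: path_joined_refl.
by apply/eqmodP/asboolP.
Qed.

Definition affine_data c (x v : data c) (t : C) : data c :=
  (fun i => x.1 i + t *: v.1 i, fun j => x.2 j + t *: v.2 j).

Lemma affine_data0 c (x v : data c) : affine_data x v 0 = x.
Proof.
rewrite /affine_data; case: x => x1 x2 /=; congr (_, _);
by apply/funext => i; rewrite scale0r addr0.
Qed.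

Lemma continuous_affine_data c (x v : data c) :
  continuous (fun t : R => affine_data x v t%:C%C).
Proof.
have c1 : continuous (fun t : R => (affine_data x v t%:C%C).1).
  apply: continuous_ptws => i; apply: continuous_mx => a b.
  rewrite (_ : (fun _ => _) = fun t => x.1 i a b + (real_complex R t) * v.1 i a b).
    exact: continuous_affine.
  by apply/funext => s; rewrite !mxE.
have c2 : continuous (fun t : R => (affine_data x v t%:C%C).2).
  apply: continuous_ptws => i; apply: continuous_mx => a b.
  rewrite (_ : (fun _ => _) = fun t => x.2 i a b + (real_complex R t) * v.2 i a b).
    exact: continuous_affine.
  by apply/funext => s; rewrite !mxE.
move=> t; exact: cvg_pair (c1 t) (c2 t).
Qed.

Lemma affine_joined c (x v : data c) :
  (forall t, stable_locus Y p (affine_data x v t)) ->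
  data_joined x (affine_data x v 1).
Proof.
move=> st hx hy.
pose g (t : R) : stable_type c :=
  stable_point (st t%:C%C).
have cg : continuous g.
  (* The stable locus carries the induced topology, so continuity is checked on the ambient data. *)
  by apply: continuous_comp_initial; exact: continuous_affine_data.
exists (fun t : R => \pi_(Quot c) (g t)); split.
- by move=> t; apply: continuous_comp (cg t) _; exact: pi_continuous.
- congr (\pi_(Quot c) _); apply: val_inj => /=.
  exact: affine_data0.
- by congr (\pi_(Quot c) _); apply: val_inj.
Qed.

(** The perturbed operator still kills [u], so the perturbation of [P] on the right-hand side
    contributes nothing. When [e *m u = 1], passing from [t = 0] to [t = 1] moves the row [e *m P]
    to [b]. *)
Lemma intertwine_line m c (P : 'M[C]_(c, m)) n M (u : 'cV[C]_c) (e q : 'rV_c) b t :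
  P *m n = M *m P -> M *m u = 0 -> b *m n = q *m P -> q *m u = 0 ->
  (P + t *: (u *m (b - e *m P))) *m n =
  (M + t *: (u *m (q - e *m M))) *m (P + t *: (u *m (b - e *m P))).
Proof.
move=> Pn Mu bn qu.
set d := b - _; set X := M + _.
have Xu : X *m u = 0.
  by rewrite mulmxDl Mu add0r -scalemxAl -mulmxA mulmxBl qu -mulmxA Mu !mulmx0
    subrr mulmx0 scaler0.
rewrite [RHS]mulmxDr -scalemxAr mulmxA Xu mul0mx scaler0 addr0 /X /d.
by rewrite !mulmxDl -!scalemxAl -!mulmxA !mulmxBl Pn bn -!mulmxA Pn.
Qed.

(* If [u] is a socle vector of [x], a generator of the quotient [x] of [z] may be
   moved along [u] towards any functional [b] on [z] that is a socle vector
   modulo the functionals [w *m P] with [w *m u = 0]. *)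
Lemma quotient_line m c (z : data m) (x : data c) (P : 'M[C]_(c, m))
    (u : 'cV[C]_c) (e : 'rV[C]_c) (b : 'rV[C]_m) (q : 'I_N -> 'rV[C]_c) :
  stable_locus Y p z -> data_hom P z x -> row_free P ->
  e *m u = 1%:M -> (forall i, (x.1 i - (p i)%:M) *m u = 0) ->
  ~~ (b <= P)%MS -> (forall i, b *m (z.1 i - (p i)%:M) = q i *m P) ->
  (forall i, q i *m u = 0) ->
  exists y, [/\ stable_locus Y p y, data_hom (P + u *m (b - e *m P)) z y &
    data_joined x y].
Proof.
move=> [zp zs] [hP1 hP2] fP eu xu bP bq qu.
pose v : data c := (fun i => u *m (q i - e *m (x.1 i - (p i)%:M)),
                    fun j => u *m (b - e *m P) *m z.2 j).
pose Pt t := P + t *: (u *m (b - e *m P)).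
have hPt t : data_hom (Pt t) z (affine_data x v t).
  split=> [i|j] /=; last by rewrite hP2 mulmxDl scalemxAl.
  have PN := intertwine_shift (p i) (hP1 i).
  have := intertwine_line e t PN (xu i) (bq i) (qu i).
  rewrite mulmxBr mul_mx_scalar addrAC mulmxBl mul_scalar_mx.
  by move/addIr.
have fPt t : row_free (Pt t).
  apply: inj_row_free => w wP.
  (* Otherwise [w *m Pt t = 0] could be solved for [b], putting [b] in the row space of [P]. *)
  have wu : t *: (w *m u) = 0.
    apply/eqP; apply: contraNT bP => twu0.
    have [k0 k0E] : exists k : C, t *: (w *m u) = k%:M.
      by exists ((t *: (w *m u)) 0 0); rewrite -mx11_scalar.
    rewrite k0E in twu0.
    have nz : k0 != 0 by apply: contraNneq twu0 => ->; rewrite raddf0.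
    have := wP; rewrite /Pt mulmxDr -scalemxAr mulmxA scalemxAl k0E mul_scalar_mx.
    rewrite scalerBr addrCA => /eqP; rewrite addr_eq0 => /eqP bE.
    by rewrite -(eqmx_scale b nz) bE eqmx_opp addmx_sub ?eqmx_opp ?scalemx_sub ?submxMl.
  apply: (row_free_inj fP); rewrite mul0mx -[RHS]wP /Pt mulmxDr -scalemxAr mulmxA.
  by rewrite scalemxAl wu mul0mx addr0.
have stab t : stable_locus Y p (affine_data x v t).
  by split; [exact: punctual_quotient (fPt t) (hPt t) zp
            |exact: stable_quotient (fPt t) (hPt t) zs].
exists (affine_data x v 1); split=> //; last exact: affine_joined.
by have := hPt 1; rewrite /Pt scale1r.
Qed.

(** Induction on the codimension of [P1 :&: P2]. The row space of [P1] is the space of functionals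
    on [z] that factor through [x1]; the hyperplane D consists of the [a *m P1] with [a *m u = 0],
    for a socle vector [u] of [x1]. *)
Lemma quotients_joined m c (z : data m) (x1 x2 : data c) (P1 P2 : 'M[C]_(c, m)) :
  stable_locus Y p z -> stable_locus Y p x1 ->
  data_hom P1 z x1 -> data_hom P2 z x2 ->
  row_free P1 -> row_free P2 -> data_joined x1 x2.
Proof.
move=> zst + + hP2 + fP2; have [[zC _ zN] _] := zst.
pose n i := z.1 i - (p i)%:M.
have nC i j : n i *m n j = n j *m n i.
  apply: comm_mxB; last exact: comm_mx_scalar.
  by apply/comm_mx_sym/comm_mxB; [exact: zC|exact: comm_mx_scalar].
have stab (P : 'M[C]_(c, m)) (x : data c) i (w : 'rV[C]_m) :
    data_hom P z x -> (w <= P)%MS -> (w *m n i <= P)%MS.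
  move=> [hP _] /submxP [a ->].
  by rewrite -mulmxA (intertwine_shift (p i) (hP i)) mulmxA submxMl.
have [k] := ubnP (c - \rank (P1 :&: P2)%MS); elim: k x1 P1 => // k IH x1 P1.
rewrite ltnS => kP x1st hP1 fP1.
have [P21|P21] := boolP (P2 <= P1)%MS.
  have /submxP [g gP] := P21.
  have gu : g \in unitmx.
    by rewrite -row_free_unit -row_leq_rank -{1}(eqP fP2) gP mxrankM_maxl.
  apply: orbit_joined; exists g; split=> // [i|j]; last by rewrite hP2.2 hP1.2 mulmxA gP.
  apply: (row_free_inj fP2); rewrite -hP2.1 gP.
  by rewrite -!mulmxA hP1.1 (mulmxA (invmx g)) mulVmx // mul1mx.
(* The socle argument for functionals: inside the row space of [P2], modulo that of [P1]. *)
have [b [bP2 bP1 bN]] : exists b : 'rV[C]_m, [/\ (b <= P2)%MS, ~ (b <= P1)%MS &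
    forall i, (b *m n i <= P1)%MS].
  have /row_subPn [a /negP aP1] := P21.
  apply: (socle_exists (f := fun i w => w *m n i)) (row_sub a P2) aP1.
  - by move=> i j w; rewrite -!mulmxA nC.
  - by move=> i w; exact: stab hP1.
  - by move=> i w; exact: stab hP2.
  - move=> i; have [l nl] := zN i; exists l => w.
    have -> : iter l (mulmxr (n i)) w = w *m (n i) ^+ l.
      elim: (l) => [|l' /= ->]; first by rewrite mulmx1.
      by rewrite -mulmxA exprSr.
    by rewrite nl mulmx0 sub0mx.
(* Dually, [s] maps to a socle vector of [x1], and [P2 *m s = 0] puts [P1 :&: P2] inside D. *)
have [s [s2 s1 sN]] : exists s : 'cV[C]_m, [/\ P2 *m s = 0, ~ (P1 *m s = 0) &
    forall i, P1 *m (n i *m s) = 0].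
  (* The columns of [cokermx P2] span the kernel of [P2]. If [P1] killed them all, its row space
     would lie in that of [P2], and equal ranks would give [P2 <= P1]. *)
  have /existsNP [j sj] : ~ forall j, P1 *m (cokermx P2 *m delta_mx j (0 : 'I_1)) = 0.
    move=> H; move: P21; rewrite -(geq_leqif (mxrank_leqif_sup _)).
      by rewrite (eqP fP1) (eqP fP2) leqnn.
    rewrite submxE; apply/eqP/matrixP => a j.
    by have /matrixP/(_ a 0) := H j; rewrite mulmxA -colE !mxE.
  apply: (socle_exists (f := fun i w => n i *m w)) sj.
  - by move=> i l w; rewrite !mulmxA nC.
  - by move=> i w; rewrite mulmxA (intertwine_shift (p i) (hP1.1 i)) -mulmxA => ->;
      rewrite mulmx0.
  - by move=> i w; rewrite mulmxA (intertwine_shift (p i) (hP2.1 i)) -mulmxA => ->;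
      rewrite mulmx0.
  - move=> i; have [l nl] := zN i; exists l => w.
    have -> : iter l (mulmx (n i)) w = (n i) ^+ l *m w.
      elim: (l) => [|l' /= ->]; first by rewrite mul1mx.
      by rewrite mulmxA exprS.
    by rewrite nl mul0mx mulmx0.
  - by rewrite mulmxA mulmx_coker mul0mx.
pose u := P1 *m s.
have [e eu] : exists e : 'rV[C]_c, e *m u = 1%:M.
  have [a ua] : exists a, u a 0 != 0.
    apply: contrapT => H; apply: s1; apply/colP => a; rewrite [RHS]mxE.
    by apply/eqP/negPn/negP => ua; apply: H; exists a.
  exists ((u a 0)^-1 *: delta_mx 0 a); rewrite -scalemxAl -rowE.
  have -> : row a u = (u a 0)%:M by rewrite [LHS]mx11_scalar [row a u 0 0]mxE.
  by rewrite scale_scalar_mx mulVf.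
have xu i : (x1.1 i - (p i)%:M) *m u = 0.
  by rewrite mulmxA -(intertwine_shift (p i) (hP1.1 i)) -mulmxA sN.
have bq i : b *m n i = (b *m n i *m pinvmx P1) *m P1 by rewrite mulmxKpV.
have qu i : (b *m n i *m pinvmx P1) *m u = 0.
  rewrite mulmxA -bq; have /submxP [a ->] := stab _ _ i _ hP2 bP2.
  by rewrite -mulmxA s2 mulmx0.
have /negP bP1' := bP1.
have [y [yst hP xy]] := quotient_line zst hP1 fP1 eu xu bP1' bq qu.
apply: (data_joined_trans yst xy).
apply: (IH _ _ _ yst hP (stable_hom_row_free hP yst.2)).
apply: leq_trans kP.
(* Elements of the old intersection are [A *m P1] with [A *m u = 0], so they survive the move; [b]
   is a new element. *)
have ltr : (\rank (P1 :&: P2)%MS < \rank ((P1 + u *m (b - e *m P1))%R :&: P2)%MS)%N.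
  apply: rank_ltmx; rewrite ltmxE; apply/andP; split.
    rewrite sub_capmx capmxSr andbT.
    have /submxP [A AE] := capmxSl P1 P2; have /submxP [A' A'E] := capmxSr P1 P2.
    have Au : A *m u = 0 by rewrite mulmxA -AE A'E -mulmxA s2 mulmx0.
    apply/submxP; exists A.
    by rewrite mulmxDr mulmxA Au mul0mx addr0.
  apply/negP => H; apply: bP1; apply: submx_trans (capmxSl P1 P2).
  apply: submx_trans H; rewrite sub_capmx bP2 andbT; apply/submxP; exists e.
  by rewrite mulmxDr mulmxA eu mul1mx addrC subrK.
apply: ltn_sub2l => //; apply: leq_trans ltr _.
by apply: leq_trans (mxrankS (capmxSr _ _)) _; rewrite (eqP fP2).
Qed.

End QuotPaths.

(** * Polynomial arcs and Newton iteration *)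

Section PolynomialArcs.
Local Open Scope ring_scope.
Variables (F : fieldType) (N : nat).
Local Notation arc := (mmap polyC).
Implicit Types (xi : 'I_N -> {poly F}) (f g : mpoly N F) (p : 'I_N -> F).

Lemma horner_arc0 xi p f :
  (forall i, (xi i).[0] = p i) -> (arc xi f).[0] = meval p f.
Proof.
move=> xip; rewrite /mmap /meval horner_sum; apply: eq_bigr => m _.
rewrite hornerM hornerC /mmap1 horner_prod; congr (_ * _).
by apply: eq_bigr => i _; rewrite horner_exp xip.
Qed.

Lemma poly_const_term (q : {poly F}) : exists q1, q = q.[0]%:P + q1 * 'X.
Proof.
have /factor_theorem [q1 q1E] : root (q - q.[0]%:P) 0.
  by rewrite /root hornerD hornerN hornerC subrr.
by exists q1; rewrite -[in RHS](subr0 'X) -q1E addrC subrK.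
Qed.

(** Induction over ring generators, so that the Taylor formula can be proved by the Leibniz rule. *)
Lemma mpoly_ind_ring (P : mpoly N F -> Prop) :
  (forall a, P (mpolyC N a)) -> (forall i, P (mpolyX F (mnm1 i))) ->
  (forall f g, P f -> P g -> P (f + g)) ->
  (forall f g, P f -> P g -> P (f * g)) -> forall f, P f.
Proof.
move=> PC PX PD PM; elim/mpolyind => [|a m f _ _ Pf].
  by rewrite -(mpolyC0 N F).
apply: PD => //; rewrite -mul_mpolyC; apply: (PM) => //.
rewrite mpolyXE_id; apply: (big_ind P) => [||i _].
- by rewrite -(mpolyC1 N F).
- exact: PM.
- elim: (m i) => [|k IH]; first by rewrite expr0 -(mpolyC1 N F).
  by rewrite exprS; apply: (PM).
Qed.

(** The derivatives may be evaluated at [p] because [xi] agrees with [p] modulo ['X]; the error is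
    absorbed in [q]. *)
Lemma arc_taylor xi p (y : 'I_N -> F) k f :
  (forall i, (xi i).[0] = p i) ->
  exists q, (arc (fun i => xi i + y i *: 'X^(k.+1)) f) = (arc xi f)
    + (\sum_i meval p (mderiv i f) * y i) *: 'X^(k.+1) + q * 'X^(k.+2).
Proof.
move=> xip; pose xi' i := xi i + y i *: 'X^(k.+1); rewrite -/xi'.
elim/mpoly_ind_ring: f => [a|i|f g [q qE] [s sE]|f g [q qE] [s sE]].
- exists 0; rewrite !mmapC big1 ?scale0r ?mul0r ?addr0 // => i _.
  by rewrite mderivC meval0 mul0r.
- exists 0; rewrite !mmapX !mmap1U mul0r addr0; congr (_ + _ *: _).
  have Ui : mnm_sub (mnm1 i) (mnm1 i) = mnm0.
    by rewrite -[X in mnm_sub X _]add0m addmK.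
  rewrite (bigD1 i) //= mderivX mnm1E eqxx scale1r Ui mpolyX0 meval1 mul1r.
  rewrite big1 ?addr0 // => j ji.
  by rewrite mderivX mnm1E eq_sym (negbTE ji) scale0r meval0 mul0r.
- exists (q + s); rewrite !mmapD qE sE.
  have -> : \sum_i meval p (mderiv i (f + g)) * y i =
      \sum_i meval p (mderiv i f) * y i + \sum_i meval p (mderiv i g) * y i.
    by rewrite -big_split /=; apply: eq_bigr => i _; rewrite mderivD mevalD mulrDl.
  by rewrite scalerDl mulrDl; ring.
- have -> : \sum_i meval p (mderiv i (f * g)) * y i =
      (\sum_i meval p (mderiv i f) * y i) * meval p g +
      (\sum_i meval p (mderiv i g) * y i) * meval p f.
    rewrite !mulr_suml -big_split /=; apply: eq_bigr => i _.
    by rewrite mderivM mevalD !mevalM; ring.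
  have [f1 f1E] := poly_const_term (arc xi f).
  have [g1 g1E] := poly_const_term (arc xi g).
  move: (\sum_i meval p (mderiv i f) * y i) qE => a qE.
  move: (\sum_i meval p (mderiv i g) * y i) sE => b sE.
  rewrite !(horner_arc0 _ xip) in f1E g1E.
  rewrite !rmorphM /= qE sE {qE sE}.
  (* The remainder of the expanded product; [f1] and [g1] enter because replacing the arcs of [f]
     and [g] by their constant terms costs one more factor ['X]. *)
  exists (a *: g1 + b *: f1 + (a * b) *: 'X^k + q * (arc xi g) + s * (arc xi f)
          + (a *: s + b *: q) * 'X^(k.+1) + q * s * 'X^(k.+2)).
  rewrite -!mul_polyC !rmorphD !rmorphM /= !exprS.
  move: (mmap _ _ f) (mmap _ _ g) f1E g1E => u v uE vE.
  rewrite {}uE {}vE; ring.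
Qed.

(* Newton iteration.  The correction at each step solves a linear system with
   matrix the Jacobian, whose kernel contains a vector with nonzero entry [i0];
   hence the correction can be taken to vanish at [i0]. *)
Lemma arc_lift M (g : 'I_M -> mpoly N F) p k :
  (M < N)%N -> (forall j, meval p (g j) = 0) ->
  row_free (\matrix_(j < M, i < N) meval p (mderiv i (g j))) ->
  exists i0 xi, [/\ forall i, (xi i).[0] = p i, xi i0 = (p i0)%:P + 'X &
    forall j, exists q, arc xi (g j) = q * 'X^(k.+1)].
Proof.
set J := \matrix_(j, i) _ => MN gp fJ.
(* As [M < N], the Jacobian has a nonzero kernel vector, scaled to have entry 1 at [i0]. *)
have [tau [i0 [Jtau tau1]]] : exists (tau : 'cV[F]_N) i0, J *m tau = 0 /\ tau i0 0 = 1.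
  have /matrix0Pn [i0 [l il]] : cokermx J != 0.
    by rewrite -mxrank_eq0 mxrank_coker (eqP fJ) subn_eq0 -ltnNge.
  exists ((cokermx J i0 l)^-1 *: (cokermx J *m delta_mx l 0)), i0; split.
    by rewrite -scalemxAr mulmxA mulmx_coker mul0mx scaler0.
  by rewrite -colE mxE [col _ _ _ _]mxE mulVf.
exists i0; elim: k => [|k [xi [xip xi0 xig]]].
  pose xi i : {poly F} := (p i)%:P + (i == i0)%:R *: 'X.
  have xip i : (xi i).[0] = p i by rewrite hornerD hornerC hornerZ hornerX mulr0 addr0.
  exists xi; split=> // [|j]; first by rewrite /xi eqxx scale1r.
  have [q qE] := poly_const_term (arc xi (g j)); exists q.
  by rewrite [LHS]qE (horner_arc0 _ xip) gp add0r expr1.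
have [q qE] := choice xig.
(* [pinvmx J] is a right inverse of [J], so [y0] cancels the leading coefficients [(q j).[0]];
   subtracting a multiple of [tau] keeps [xi i0] fixed. *)
pose y0 := pinvmx J *m (\col_j - (q j).[0]).
pose y := y0 - y0 i0 0 *: tau.
have Jy j : \sum_i meval p (mderiv i (g j)) * y i 0 = - (q j).[0].
  have -> : \sum_i meval p (mderiv i (g j)) * y i 0 = (J *m y) j 0.
    by rewrite [RHS]mxE; apply: eq_bigr => i _; rewrite [J _ _]mxE.
  by rewrite mulmxBr -scalemxAr Jtau scaler0 subr0 mulmxA mulmxVp // mul1mx mxE.
have y_0 : y i0 0 = 0 by rewrite !mxE tau1 mulr1 subrr.
exists (fun i => xi i + y i 0 *: 'X^(k.+1)); split=> [i||j].
- by rewrite hornerD hornerZ hornerXn xip expr0n mulr0 addr0.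
- by rewrite xi0 y_0 scale0r addr0.
have [s ->] := arc_taylor (fun i => y i 0) k (g j) xip.
have [q1 q1E] := poly_const_term (q j).
exists (q1 + s); rewrite Jy qE -mul_polyC rmorphN /= !exprS.
move: (q j) q1E => Q; move: Q.[0] => a ->; ring.
Qed.

End PolynomialArcs.

(** * Curvilinear quotients supported at a smooth point *)

Section Curvilinear.
Local Open Scope ring_scope.

(** Multiplication by T on F[T]/(T^n) in the monomial basis. *)
Definition shift_mx (F : fieldType) n : 'M[F]_n := \matrix_(i, j) (i == j.+1 :> nat)%:R.

Lemma shift_mx_expr (F : fieldType) n k :
  shift_mx F n ^+ k = \matrix_(i, j) (i == (j + k)%N :> nat)%:R.
Proof.
elim: k => [|k IH]; apply/matrixP => i j.
  by rewrite expr0 !mxE addn0.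
rewrite exprSr IH !mxE.
have [lt_n|le_n] := ltnP j.+1 n.
  rewrite (bigD1 (Ordinal lt_n)) //= !mxE eqxx mulr1 big1 ?addr0 ?addSnnS // => l nl.
  by rewrite !mxE (_ : l == j.+1 :> nat = false) ?mulr0 //; apply/negbTE.
rewrite big1 => [|l _]; last first.
  by rewrite !mxE (@ltn_eqF l) ?mulr0 // (leq_trans (ltn_ord l)).
rewrite ltn_eqF // (leq_trans (ltn_ord i)) // (leq_trans le_n) //.
by rewrite addnS ltnS leq_addr.
Qed.

Variables (R : realType) (N r : nat) (Y : set ('I_N -> R[i])) (p : 'I_N -> R[i]).
Local Notation C := R[i].

(** The truncated arc makes C[T]/(T^c) a module over the coordinate ring. It is generated by 1,
    since the coordinate [i0], shifted by [p i0], acts as T. *)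
Lemma curvilinear_point n c : (0 < n)%N -> (0 < c)%N -> (0 < r)%N ->
  smooth_at n Y p -> Y p ->
  exists x : quot_data c r, stable_locus Y p x.
Proof.
move=> n0; case: c => // c _ r0 [nN [g [gY fJ gI]]] Yp.
have MN : (N - n < N)%N by rewrite ltn_subrL n0 (leq_trans n0 nN).
(* The length is now [c.+1], exactly the order to which each [g j] vanishes along the arc. *)
have [i0 [xi [xip xi0 xig]]] := arc_lift c MN (fun j => gY j p Yp) fJ.
pose S : 'M[C]_c.+1 := shift_mx _ _.
have Sc : S ^+ c.+1 = 0.
  rewrite shift_mx_expr; apply/matrixP => i j; rewrite !mxE ltn_eqF //.
  by rewrite (leq_trans (ltn_ord i)) // leq_addl.
pose B i := horner_mx S (xi i).
have BE f : mx_eval B f = horner_mx S (mmap polyC xi f).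
  rewrite /mx_eval /mmap rmorph_sum /=; apply: eq_bigr => m _.
  rewrite -mul_scalar_mx rmorphM /= horner_mx_C; congr (_ * _).
  by rewrite rmorph_prod; apply: eq_bigr => i _; rewrite rmorphXn.
pose x : quot_data c.+1 r :=
  (B, fun j => if j == Ordinal r0 then delta_mx 0 0 else 0).
exists x; split; last first.
  move=> V VB Vv; apply/vspaceP => w; rewrite memvf.
  have SE : S = B i0 - (p i0)%:M.
    by rewrite /B xi0 rmorphD /= horner_mx_C horner_mx_X addrC addKr.
  have SV (s : 'cV[C]_c.+1) : s \in V -> S *m s \in V.
    move=> sV; rewrite SE mulmxBl mul_scalar_mx; apply: memvB; last exact: memvZ.
    exact: VB.
  have VS k : S ^+ k *m delta_mx 0 (0 : 'I_1) \in V.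
    elim: k => [|k IH]; first by have := Vv (Ordinal r0); rewrite expr0 mul1mx /= ?eqxx.
    by rewrite exprS -mulmxE -mulmxA; exact: SV.
  rewrite (matrix_sum_delta w); apply: memv_suml => k _; rewrite big_ord1; apply: memvZ.
  have -> : delta_mx k 0 = S ^+ k *m delta_mx 0 (0 : 'I_1) => //.
  by rewrite shift_mx_expr -colE; apply/matrixP => a b; rewrite !mxE ord1 eqxx andbT.
split=> [i j|f fY|i].
- by rewrite !mulmxE -!rmorphM mulrC.
- have [h [a [hp hf]]] := gI f fY; rewrite BE.
  (* Along the arc, [h * f] is divisible by ['X^(c.+1)], while [h] is coprime to ['X] because it
     does not vanish at [p]. *)
  have /dvdpP [q ->] : 'X^(c.+1) %| mmap polyC xi f.
    rewrite -(@Gauss_dvdpr _ _ (mmap polyC xi h)).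
      rewrite -rmorphM hf rmorph_sum /=.
      apply: (big_ind (fun u => 'X^(c.+1) %| u)) => [||j _].
      + exact: dvdp0.
      + exact: dvdp_add.
      + by have [q qE] := xig j; rewrite rmorphM /= qE mulrA dvdp_mull.
    apply: coprimep_expl; rewrite coprimep_sym coprimepX /root.
    by rewrite (horner_arc0 _ xip).
  by rewrite rmorphM rmorphXn /= horner_mx_X Sc mulr0.
- exists c.+1; have [q qE] := poly_const_term (xi i).
  rewrite /= /B qE xip rmorphD /= horner_mx_C addrC addKr -rmorphXn /= exprMn.
  by rewrite rmorphM !rmorphXn /= horner_mx_X Sc mulr0.
Qed.

End Curvilinear.

Theorem corollary6p5 (R : realType) (n c r N : nat)
    (Y : set ('I_N -> R[i])) (p : 'I_N -> R[i]) :
  0 < n -> 0 < c -> n <= r ->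
  smooth_affine_variety n Y -> Y p ->
  path_connected R (punctual_Quot Y p c r).
Proof.
move=> n0 c0 nr [_ smY] Yp; split.
  have [x xst] := curvilinear_point n0 c0 (leq_trans n0 nr) (smY p Yp) Yp.
  by exists (Quot_class xst).
move=> a b.
have repr_class (q : punctual_Quot Y p c r) :
    exists (x : quot_data c r) (h : stable_locus Y p x), q = Quot_class h.
  exists (set_val (repr q)), (set_mem (valP (repr q))).
  rewrite -[LHS]reprK; congr (\pi_(punctual_Quot Y p c r)%qT _).
  exact: val_inj.
have [x [hx ->]] := repr_class a; have [y [hy ->]] := repr_class b.
have [m [z [P1 [P2 [h1 h2 hz]]]]] := stable_common_cover hx hy.
have f1 := stable_hom_row_free h1 hx.2; have f2 := stable_hom_row_free h2 hy.2.
have [gamma [cg g0 g1]] := quotients_joined hz hx h1 h2 f1 f2 hx hy.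
by exists gamma; split=> //; exact: continuous_subspaceT.
Qed.
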